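(* Let $\mathfrak{g}$ be a Lie algebra over $\mathbb{Q}$ with bracket $\nabla:\mathfrak{g}\otimes\mathfrak{g}\to\mathfrak{g}$, and let $\delta:\mathfrak{g}\to\Lambda^2\mathfrak{g}$ be a $\mathbb{Q}$-linear map. Let $\partial:\Lambda^p\mathfrak{g}\to\Lambda^{p-1}\mathfrak{g}$ be the standard boundary operator of the Lie algebra $\mathfrak{g}$, and let $d:\Lambda^p\mathfrak{g}\to\Lambda^{p+1}\mathfrak{g}$ $(p\ge 0)$ be the natural extension of $\delta$. Then the pair $(\mathfrak{g},\delta)$ is an involutive Lie bialgebra if and only if $dd=0$ and $d\partial+\partial d=0$ on $\Lambda^*\mathfrak{g}=\bigoplus_{p\ge0}\Lambda^p\mathfrak{g}$.
   Context: All vector spaces are over $\mathbb{Q}$. For a vector space $V$, $\Lambda^pV\subset V^{\otimes p}$ is the subspace of antisymmetric tensors, $X_1\wedge\cdots\wedge X_p:=\sum_{s\in\mathfrak{S}_p}(\operatorname{sgn}s)\,X_{s(1)}\otimes\cdots\otimes X_{s(p)}$, and the wedge product $\Lambda^pV\times\Lambda^qV\to\Lambda^{p+q}V$ is the bilinear map with $(X_1\wedge\cdots\wedge X_p)\wedge(X_{p+1}\wedge\cdots\wedge X_{p+q})=X_1\wedge\cdots\wedge X_{p+q}$. In particular $X\wedge Y=X\otimes Y-Y\otimes X$. Write $N:=1+(123)+(123)^2$ for the sum of the cyclic permutations acting on $V^{\otimes 3}$. Write $[X,Y]=\nabla(X\otimes Y)$. For $Y\in\mathfrak{g}$ put $\sigma(Y)(X_1\wedge\cdots\wedge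 X_p):=\sum_{i=1}^pX_1\wedge\cdots\wedge X_{i-1}\wedge[Y,X_i]\wedge X_{i+1}\wedge\cdots\wedge X_p$. The boundary operator is $\partial(X_1\wedge\cdots\wedge X_p):=\sum_{i<j}(-1)^{i+j}[X_i,X_j]\wedge X_1\wedge\cdots\widehat{X_i}\cdots\widehat{X_j}\cdots\wedge X_p$ (hats denote omission; $\partial=0$ on $\Lambda^0\mathfrak{g}$ and $\Lambda^1\mathfrak{g}$). The operator $d$ is $d|_{\Lambda^0\mathfrak{g}}:=0$ and $d(X_1\wedge\cdots\wedge X_p):=\sum_{i=1}^p(-1)^i(\delta X_i)\wedge X_1\wedge\cdots\widehat{X_i}\cdots\wedge X_p$ for $p\ge1$; in particular $dX=-\delta X$ for $X\in\mathfrak{g}$. $(\mathfrak{g},\delta)$ is a Lie coalgebra if $\delta$ satisfies the coJacobi identity $N(\delta\otimes1)\delta=0:\mathfrak{g}\to\mathfrak{g}^{\otimes3}$. A Lie algebra $\mathfrak{g}$ with a Lie coalgebra structure $\delta$ is a Lie bialgebra if the compatibility condition $\delta[X,Y]=\sigma(X)(\delta Y)-\sigma(Y)(\delta X)$ holds for all $X,Y\in\mathfrak{g}$. A Lie bialgebra is involutive if $\nabla\delta=0:\mathfrak{g}\to\mathfrak{g}$. *)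

(* Defs.v *)
From HB Require Import structures.
From mathcomp Require Import all_fingroup.
From mathcomp Require Import all_boot all_order all_algebra.
From mathcomp Require Import boolp zify.

Set Implicit Arguments.
Unset Strict Implicit.
Unset Printing Implicit Defensive.

Import GRing.Theory Num.Theory.
Local Open Scope ring_scope.
Local Open Scope quotient_scope.

Definition linear_of (U W : lmodType rat) (f : U -> W) (lf : linear f) :
  {linear U -> W} := HB.pack f (GRing.isLinear.Build rat U W *:%R f lf).

Section Tuples.
Variables (T : Type) (p : nat).
Implicit Types (X : p.-tuple T) (i : 'I_p).

Definition set_entry X i (x : T) : p.-tuple T :=
  [tuple if j == i then x else tnth X j | j < p].

Definition permute (s : 'S_p) X : p.-tuple T := [tuple tnth X (s i) | i < p].

End Tuples.

Definition omit (T : Type) (p : nat) (i : 'I_p.+1) (X : p.+1.-tuple T) :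
  p.-tuple T := [tuple tnth X (lift i k) | k < p].

Definition multilinear (V W : lmodType rat) (p : nat) (f : p.-tuple V -> W) :=
  forall (X : p.-tuple V) (i : 'I_p) (a : rat) (x y : V),
    f (set_entry X i (a *: x + y)) =
    a *: f (set_entry X i x) + f (set_entry X i y).

Definition alternating (V W : lmodType rat) (p : nat) (f : p.-tuple V -> W) :=
  forall (s : 'S_p) (X : p.-tuple V), f (permute s X) = (-1) ^+ s *: f X.

(* The p-th tensor power of V: formal rational combinations of p-tuples of
   vectors, two of them being identified when no multilinear map separates
   them.  [tens_multilinear], [tlift_linear], [tlift_tens] and [tpow_ext] below
   are the universal property. *)
Section TensorPower.
Variables (V : lmodType rat) (p : nat).

Local Notation formal_sum := (seq (rat * p.-tuple V)).

Definition eval_sum (W : lmodType rat) (f : p.-tuple V -> W) (u : formal_sum) :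
  W := \sum_(c <- u) c.1 *: f c.2.

Definition tens_eq (u v : formal_sum) : bool :=
  `[< forall (W : lmodType rat) (f : p.-tuple V -> W),
        multilinear f -> eval_sum f u = eval_sum f v >].

Lemma tens_eq_refl : reflexive tens_eq.
Proof. by move=> u; apply/asboolP. Qed.

Lemma tens_eq_sym : symmetric tens_eq.
Proof. by move=> u v; apply/asboolP/asboolP => uv W f mf; rewrite uv. Qed.

Lemma tens_eq_trans : transitive tens_eq.
Proof.
move=> v u w /asboolP uv /asboolP vw; apply/asboolP => W f mf.
by rewrite uv // vw.
Qed.

Canonical tens_eq_equiv := EquivRel tens_eq
  tens_eq_refl tens_eq_sym tens_eq_trans.

Definition tpow : Type := {eq_quot tens_eq}.
HB.instance Definition _ := Choice.on tpow.
HB.instance Definition _ := EqQuotient.on tpow.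

Definition tlift (W : lmodType rat) (f : p.-tuple V -> W) (x : tpow) : W :=
  eval_sum f (repr x).

Definition tens (X : p.-tuple V) : tpow := \pi_tpow [:: (1, X)].

Lemma tlift_pi (W : lmodType rat) (f : p.-tuple V -> W) u :
  multilinear f -> tlift f (\pi_tpow u) = eval_sum f u.
Proof.
move=> mf; have /eqmodP/asboolP := reprK (\pi_tpow u).
exact.
Qed.

Lemma tpow_eqP (x y : tpow) :
  (forall (W : lmodType rat) (f : p.-tuple V -> W),
     multilinear f -> tlift f x = tlift f y) -> x = y.
Proof.
by move=> xy; rewrite -[x]reprK -[y]reprK; apply/eqmodP/asboolP.
Qed.

Definition tpow_zero : tpow := \pi_tpow [::].
Definition tpow_add (x y : tpow) : tpow := \pi_tpow (repr x ++ repr y).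
Definition tpow_scale (a : rat) (x : tpow) : tpow :=
  \pi_tpow [seq (a * c.1, c.2) | c <- repr x].
Definition tpow_opp (x : tpow) : tpow := tpow_scale (-1) x.

Section Lift.
Variables (W : lmodType rat) (f : p.-tuple V -> W).
Hypothesis mf : multilinear f.

Fact tlift0_subproof : tlift f tpow_zero = 0.
Proof. by rewrite tlift_pi // /eval_sum big_nil. Qed.

Fact tliftD_subproof x y : tlift f (tpow_add x y) = tlift f x + tlift f y.
Proof. by rewrite tlift_pi // /eval_sum big_cat. Qed.

Fact tliftZ_subproof a x : tlift f (tpow_scale a x) = a *: tlift f x.
Proof.
rewrite tlift_pi // /eval_sum big_map /tlift /eval_sum scaler_sumr.
by apply: eq_bigr => c _; rewrite scalerA.
Qed.
End Lift.

Let liftE := (tlift0_subproof, tliftD_subproof, tliftZ_subproof).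

Fact tpow_addA : associative tpow_add.
Proof. by move=> x y z; apply: tpow_eqP => W f mf; rewrite !liftE // addrA. Qed.
Fact tpow_addC : commutative tpow_add.
Proof. by move=> x y; apply: tpow_eqP => W f mf; rewrite !liftE // addrC. Qed.
Fact tpow_add0 : left_id tpow_zero tpow_add.
Proof. by move=> x; apply: tpow_eqP => W f mf; rewrite !liftE // add0r. Qed.
Fact tpow_addN : left_inverse tpow_zero tpow_opp tpow_add.
Proof.
by move=> x; apply: tpow_eqP => W f mf; rewrite !liftE // scaleN1r addNr.
Qed.

HB.instance Definition _ :=
  GRing.isZmodule.Build tpow tpow_addA tpow_addC tpow_add0 tpow_addN.

Fact tpow_scaleA a b x : tpow_scale a (tpow_scale b x) = tpow_scale (a * b) x.
Proof. by apply: tpow_eqP => W f mf; rewrite !liftE // scalerA. Qed.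
Fact tpow_scale1 : left_id 1 tpow_scale.
Proof. by move=> x; apply: tpow_eqP => W f mf; rewrite !liftE // scale1r. Qed.
Fact tpow_scaleDr : right_distributive tpow_scale +%R.
Proof.
by move=> a x y; apply: tpow_eqP => W f mf; rewrite !liftE // scalerDr.
Qed.
Fact tpow_scaleDl x : {morph tpow_scale^~ x : a b / a + b}.
Proof.
by move=> a b; apply: tpow_eqP => W f mf; rewrite !liftE // scalerDl.
Qed.

HB.instance Definition _ := GRing.Zmodule_isLmodule.Build rat tpow
  tpow_scaleA tpow_scale1 tpow_scaleDr tpow_scaleDl.

Lemma tlift_linear (W : lmodType rat) (f : p.-tuple V -> W) :
  multilinear f -> linear (tlift f).
Proof. by move=> mf a x y; rewrite liftE // liftE. Qed.

Lemma tlift_tens (W : lmodType rat) (f : p.-tuple V -> W) X :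
  multilinear f -> tlift f (tens X) = f X.
Proof. by move=> mf; rewrite tlift_pi // /eval_sum big_seq1 scale1r. Qed.

Lemma tens_multilinear : multilinear tens.
Proof.
move=> X i a x y; apply: tpow_eqP => W f mf.
by rewrite (tlift_linear mf) !tlift_tens.
Qed.

Lemma tpow_span (x : tpow) : x = \sum_(c <- repr x) c.1 *: tens c.2.
Proof.
apply: tpow_eqP => W f mf.
rewrite -[RHS]/(linear_of (tlift_linear mf) _) linear_sum.
by apply: eq_bigr => c _; rewrite linearZ /= tlift_tens.
Qed.

Lemma tpow_ext (W : lmodType rat) (h k : {linear tpow -> W}) :
  (forall X, h (tens X) = k (tens X)) -> h =1 k.
Proof.
move=> hk x; rewrite [x]tpow_span !linear_sum /=.
by apply: eq_bigr => c _; rewrite !linearZ /= hk.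
Qed.

End TensorPower.

Section MultilinearTheory.
Variables (V W : lmodType rat) (p : nat).
Implicit Types (f : p.-tuple V -> W) (X : p.-tuple V) (s : 'S_p).

Lemma permute_set s X i x :
  permute s (set_entry X i x) = set_entry (permute s X) ((s^-1)%g i) x.
Proof.
apply: eq_from_tnth => j; rewrite !tnth_mktuple.
by rewrite (canF_eq (permK s)).
Qed.

Lemma permuteM s t X : permute s (permute t X) = permute (s * t)%g X.
Proof. by apply: eq_from_tnth => j; rewrite !tnth_mktuple permM. Qed.

Lemma permute1 X : permute 1 X = X.
Proof. by apply: eq_from_tnth => j; rewrite !tnth_mktuple perm1. Qed.

Lemma multilinear_permute f s :
  multilinear f -> multilinear (fun X => f (permute s X)).
Proof. by move=> mf X i a x y; rewrite !permute_set mf. Qed.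

Lemma multilinear_sum I (r : seq I) (P : pred I) (F : I -> p.-tuple V -> W) :
  (forall i, P i -> multilinear (F i)) ->
  multilinear (fun X => \sum_(i <- r | P i) F i X).
Proof.
move=> mF X k a x y; rewrite scaler_sumr -big_split.
by apply: eq_bigr => i Pi; rewrite mF.
Qed.

Lemma multilinear_scale (b : rat) f :
  multilinear f -> multilinear (fun X => b *: f X).
Proof. by move=> mf X k a x y; rewrite mf scalerDr !scalerA mulrC. Qed.

Lemma multilinear_comp (U : lmodType rat) (h : {linear W -> U}) f :
  multilinear f -> multilinear (fun X => h (f X)).
Proof. by move=> mf X k a x y; rewrite mf linearP. Qed.

Lemma alternating_tperm f :
  (forall (i j : 'I_p) X, i != j -> f (permute (tperm i j) X) = - f X) ->
  alternating f.
Proof.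
move=> tf s; have [ts -> dts] := prod_tpermP s.
elim: ts dts => [_|t ts IH /= /andP[dt dts]] X.
  by rewrite big_nil permute1 odd_perm1 scale1r.
rewrite big_cons -permuteM tf // IH // odd_mul_tperm (dt : t.1 != t.2).
by rewrite signrN scaleNr.
Qed.

End MultilinearTheory.

(* [tpact s (X_1 (x) ... (x) X_p) = X_{s 1} (x) ... (x) X_{s p}] *)
Definition tpact (V : lmodType rat) (p : nat) (s : 'S_p) : tpow V p -> tpow V p :=
  tlift (fun X => tens (permute s X)).

Section ExteriorPower.
Variables (V : lmodType rat) (p : nat).
Implicit Types (X : p.-tuple V) (s : 'S_p).

Lemma tpact_multilinear s : multilinear (fun X => tens (permute s X)).
Proof. exact/multilinear_permute/tens_multilinear. Qed.

Lemma tpact_linear s : linear (@tpact V p s).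
Proof. exact/tlift_linear/tpact_multilinear. Qed.

HB.instance Definition _ s :=
  GRing.isLinear.Build rat (tpow V p) (tpow V p) *:%R (@tpact V p s)
    (tpact_linear s).

Lemma tpact_tens s X : tpact s (tens X) = tens (permute s X).
Proof. exact/tlift_tens/tpact_multilinear. Qed.

Definition antisym : pred (tpow V p) :=
  fun x => [forall s : 'S_p, tpact s x == (-1) ^+ s *: x].

Fact antisym_submod : subsemimod_closed antisym.
Proof.
split; first split.
- by apply/forallP=> s; rewrite linear0 scaler0.
- move=> x y /forallP ax /forallP ay; apply/forallP=> s.
  by rewrite linearD /= (eqP (ax s)) (eqP (ay s)) scalerDr.
- move=> a x /forallP ax; apply/forallP=> s.
  by rewrite linearZ /= (eqP (ax s)) !scalerA mulrC.
Qed.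

Record ext := Ext { ext_val : tpow V p; ext_antisym : antisym ext_val }.

HB.instance Definition _ := [isSub of ext for ext_val].
HB.instance Definition _ := [Choice of ext by <:].
HB.instance Definition _ :=
  GRing.SubChoice_isSubLmodule.Build rat (tpow V p) antisym ext antisym_submod.

Definition antisymmetrize X : tpow V p :=
  \sum_(s : 'S_p) (-1) ^+ s *: tens (permute s X).

Fact antisymmetrize_antisym X : antisym (antisymmetrize X).
Proof.
apply/forallP=> t; apply/eqP; rewrite linear_sum /= scaler_sumr.
rewrite (reindex_inj (mulgI (t^-1)%g)) /=; apply: eq_bigr => s _.
rewrite linearZ /= tpact_tens permuteM mulKVg scalerA; congr (_ *: _).
by rewrite odd_permM odd_permV signr_addb.
Qed.

Definition wedge X : ext := Ext (antisymmetrize_antisym X).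

Lemma wedge_multilinear : multilinear wedge.
Proof.
move=> X i a x y; apply: val_inj; rewrite [RHS]linearP /=.
have mA: multilinear antisymmetrize; last exact: mA.
by apply: multilinear_sum => s _; exact/multilinear_scale/tpact_multilinear.
Qed.

Lemma wedge_alternating : alternating wedge.
Proof.
move=> t X; apply: val_inj; rewrite linearZ /= scaler_sumr.
rewrite [RHS](reindex_inj (mulIg t)) /=; apply: eq_bigr => s _.
rewrite permuteM scalerA; congr (_ *: _).
by rewrite odd_permM -signr_addb addbC addbK.
Qed.

(* The linear map on the p-th exterior power sending X_1 /\ ... /\ X_p to
   f (X_1, ..., X_p), for f multilinear and alternating; since
   X_1 /\ ... /\ X_p is a sum of p! tensors on which f takes the same value up
   to sign, it is 1/p! times the restriction of the map induced by f on tensors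
   (see [extlift_wedge]). *)
Definition extlift (W : lmodType rat) (f : p.-tuple V -> W) (x : ext) : W :=
  (p`!%:R)^-1 *: tlift f (ext_val x).

Lemma fact_neq0 : p`!%:R != 0 :> rat.
Proof. by rewrite pnatr_eq0 -lt0n fact_gt0. Qed.

Lemma sum_sign_perm (W : lmodType rat) (w : W) :
  \sum_(s : 'S_p) (-1) ^+ s *: ((-1 : rat) ^+ s *: w) = p`!%:R *: w.
Proof.
rewrite (eq_bigr (fun=> w)) => [|s _]; last first.
  by rewrite scalerA -signr_addb addbb scale1r.
by rewrite sumr_const -scaler_nat card_Sn.
Qed.

Lemma extlift_linear (W : lmodType rat) (f : p.-tuple V -> W) :
  multilinear f -> linear (extlift f).
Proof.
move=> mf a x y; rewrite /extlift -[ext_val (_ + _)]/(val _) linearP /=.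
rewrite tlift_linear // scalerDr !scalerA.
by rewrite mulrC.
Qed.

Lemma extlift_wedge (W : lmodType rat) (f : p.-tuple V -> W) X :
  multilinear f -> alternating f -> extlift f (wedge X) = f X.
Proof.
move=> mf af.
have H : tlift f (antisymmetrize X) =
    \sum_(s : 'S_p) (-1) ^+ s *: ((-1) ^+ s *: f X).
  rewrite -[LHS]/(linear_of (tlift_linear mf) _) linear_sum.
  by apply: eq_bigr => s _; rewrite linearZ /= tlift_tens // af.
by rewrite /extlift H sum_sign_perm scalerA mulVf ?fact_neq0 ?scale1r.
Qed.

Lemma ext_span (x : ext) :
  x = \sum_(c <- repr (ext_val x)) ((p`!%:R)^-1 * c.1) *: wedge c.2.
Proof.
apply: val_inj; rewrite linear_sum /=.
have: p`!%:R *: ext_val x = \sum_(c <- repr (ext_val x)) c.1 *: antisymmetrize c.2.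
  have tx s : (-1) ^+ s *: ext_val x =
      \sum_(c <- repr (ext_val x)) c.1 *: tens (permute s c.2).
    have /eqP <- := forallP (ext_antisym x) s.
    rewrite {1}[ext_val x]tpow_span linear_sum.
    by apply: eq_bigr => c _; rewrite linearZ /= tpact_tens.
  rewrite -sum_sign_perm; under eq_bigr => s _ do rewrite tx scaler_sumr.
  rewrite exchange_big /=; apply: eq_bigr => c _; rewrite scaler_sumr.
  by apply: eq_bigr => s _; rewrite !scalerA mulrC.
move/(congr1 (fun z => (p`!%:R)^-1 *: z)).
rewrite scalerA mulVf ?fact_neq0 // scale1r scaler_sumr => {1}->.
by apply: eq_bigr => c _; rewrite scalerA.
Qed.

Lemma ext_ext (W : lmodType rat) (h k : {linear ext -> W}) :
  (forall X, h (wedge X) = k (wedge X)) -> h =1 k.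
Proof.
move=> hk x; rewrite [x]ext_span !linear_sum /=.
by apply: eq_bigr => c _; rewrite !linearZ /= hk.
Qed.

End ExteriorPower.

Section Products.
Variable V : lmodType rat.

Lemma tlift_comb (W : lmodType rat) p (F G H : p.-tuple V -> W) a x :
  (forall X, F X = a *: G X + H X) ->
  tlift F x = a *: tlift G x + tlift H x.
Proof.
move=> FGH; rewrite /tlift /eval_sum scaler_sumr -big_split /=.
by apply: eq_bigr => c _; rewrite FGH scalerDr !scalerA mulrC.
Qed.

Lemma extlift_comb (W : lmodType rat) p (F G H : p.-tuple V -> W) a x :
  (forall X, F X = a *: G X + H X) ->
  extlift F x = a *: extlift G x + extlift H x.
Proof.
by move=> /tlift_comb FGH; rewrite /extlift FGH scalerDr !scalerA mulrC.
Qed.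

Definition tmul (p q : nat) (x : tpow V p) (y : tpow V q) : tpow V (p + q) :=
  tlift (fun X : p.-tuple V =>
    tlift (fun Y : q.-tuple V => tens [tuple of X ++ Y]) y) x.

Definition ext_mul (p q : nat) (x : ext V p) (y : ext V q) : ext V (p + q) :=
  extlift (fun X : p.-tuple V =>
    extlift (fun Y : q.-tuple V => wedge [tuple of X ++ Y]) y) x.

Lemma cat_set_l p q (X : p.-tuple V) (Y : q.-tuple V) i x :
  [tuple of set_entry X i x ++ Y] =
  set_entry [tuple of X ++ Y] (lshift q i) x.
Proof.
apply: eq_from_tnth => j; rewrite tnth_mktuple.
case: (split_ordP j) => k ->; rewrite ?tnth_lshift ?tnth_rshift.
  by rewrite tnth_mktuple eq_lshift.
by rewrite eq_rlshift.
Qed.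

Lemma cat_set_r p q (X : p.-tuple V) (Y : q.-tuple V) i x :
  [tuple of X ++ set_entry Y i x] =
  set_entry [tuple of X ++ Y] (rshift p i) x.
Proof.
apply: eq_from_tnth => j; rewrite tnth_mktuple.
case: (split_ordP j) => k ->; rewrite ?tnth_lshift ?tnth_rshift.
  by rewrite eq_lrshift.
by rewrite tnth_mktuple eq_rshift.
Qed.

Lemma cat_tperm_l p q (X : p.-tuple V) (Y : q.-tuple V) i j :
  [tuple of permute (tperm i j) X ++ Y] =
  permute (tperm (lshift q i) (lshift q j)) [tuple of X ++ Y].
Proof.
apply: eq_from_tnth => k; rewrite tnth_mktuple.
case: (split_ordP k) => l ->; rewrite ?tnth_lshift ?tnth_rshift.
  rewrite tnth_mktuple -(inj_tperm _ _ _ (@lshift_inj p q)).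
  by rewrite tnth_lshift.
by rewrite tpermD ?tnth_rshift // eq_lrshift.
Qed.

Lemma cat_tperm_r p q (X : p.-tuple V) (Y : q.-tuple V) i j :
  [tuple of X ++ permute (tperm i j) Y] =
  permute (tperm (rshift p i) (rshift p j)) [tuple of X ++ Y].
Proof.
apply: eq_from_tnth => k; rewrite tnth_mktuple.
case: (split_ordP k) => l ->; rewrite ?tnth_lshift ?tnth_rshift.
  by rewrite tpermD ?tnth_lshift // eq_rlshift.
rewrite tnth_mktuple -(inj_tperm _ _ _ (@rshift_inj p q)).
by rewrite tnth_rshift.
Qed.

Section Cat.
Variables (W : lmodType rat) (p q : nat) (f : (p + q).-tuple V -> W).

Lemma multilinear_cat_l (Y : q.-tuple V) :
  multilinear f -> multilinear (fun X : p.-tuple V => f [tuple of X ++ Y]).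
Proof. by move=> mf X i a x y; rewrite !cat_set_l mf. Qed.

Lemma multilinear_cat_r (X : p.-tuple V) :
  multilinear f -> multilinear (fun Y : q.-tuple V => f [tuple of X ++ Y]).
Proof. by move=> mf Y i a x y; rewrite !cat_set_r mf. Qed.

Lemma alternating_cat_l (Y : q.-tuple V) :
  alternating f -> alternating (fun X : p.-tuple V => f [tuple of X ++ Y]).
Proof.
move=> af; apply: alternating_tperm => i j X ij.
rewrite cat_tperm_l af odd_tperm (inj_eq (@lshift_inj p q)) ij.
by rewrite expr1 scaleN1r.
Qed.

Lemma alternating_cat_r (X : p.-tuple V) :
  alternating f -> alternating (fun Y : q.-tuple V => f [tuple of X ++ Y]).
Proof.
move=> af; apply: alternating_tperm => i j Y ij.
rewrite cat_tperm_r af odd_tperm (inj_eq (@rshift_inj p q)) ij.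
by rewrite expr1 scaleN1r.
Qed.

Lemma multilinear_tlift_cat (y : tpow V q) : multilinear f ->
  multilinear (fun X : p.-tuple V => tlift (fun Y => f [tuple of X ++ Y]) y).
Proof.
by move=> mf X i a x z; apply: tlift_comb => Y; apply: multilinear_cat_l.
Qed.

Lemma multilinear_extlift_cat (y : ext V q) : multilinear f ->
  multilinear (fun X : p.-tuple V => extlift (fun Y => f [tuple of X ++ Y]) y).
Proof.
by move=> mf X i a x z; apply: extlift_comb => Y; apply: multilinear_cat_l.
Qed.

Lemma alternating_extlift_cat (y : ext V q) : alternating f ->
  alternating (fun X : p.-tuple V => extlift (fun Y => f [tuple of X ++ Y]) y).
Proof.
move=> af s X; rewrite /extlift scalerA mulrC -scalerA; congr (_ *: _).
rewrite /tlift /eval_sum scaler_sumr; apply: eq_bigr => c _.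
by rewrite (alternating_cat_l _ af) !scalerA mulrC.
Qed.
End Cat.

Lemma tmul_tens p q (X : p.-tuple V) (Y : q.-tuple V) :
  tmul (tens X) (tens Y) = tens [tuple of X ++ Y].
Proof.
rewrite /tmul tlift_tens ?tlift_tens //.
  exact/multilinear_cat_r/tens_multilinear.
exact/multilinear_tlift_cat/tens_multilinear.
Qed.

Lemma tmul_linear_l p q (y : tpow V q) : linear (fun x : tpow V p => tmul x y).
Proof. exact/tlift_linear/multilinear_tlift_cat/tens_multilinear. Qed.

Lemma tmul_linear_r p q (x : tpow V p) : linear (@tmul p q x).
Proof.
move=> a y z; apply: tlift_comb => X.
exact/tlift_linear/multilinear_cat_r/tens_multilinear.
Qed.

Lemma ext_mul_wedge p q (X : p.-tuple V) (Y : q.-tuple V) :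
  ext_mul (wedge X) (wedge Y) = wedge [tuple of X ++ Y].
Proof.
have mw := @wedge_multilinear V (p + q); have aw := @wedge_alternating V (p + q).
rewrite /ext_mul extlift_wedge.
- by rewrite extlift_wedge; [|exact: multilinear_cat_r|exact: alternating_cat_r].
- exact: multilinear_extlift_cat.
- exact: alternating_extlift_cat.
Qed.

Lemma ext_mul_linear_l p q (y : ext V q) :
  linear (fun x : ext V p => ext_mul x y).
Proof. exact/extlift_linear/multilinear_extlift_cat/wedge_multilinear. Qed.

Lemma ext_mul_linear_r p q (x : ext V p) : linear (@ext_mul p q x).
Proof.
move=> a y z; apply: extlift_comb => X.
exact/extlift_linear/multilinear_cat_r/wedge_multilinear.
Qed.

Lemma ext_mulZr p q a (x : ext V p) (y : ext V q) :
  ext_mul x (a *: y) = a *: ext_mul x y.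
Proof. exact: (linearZ_LR (linear_of (ext_mul_linear_r x))). Qed.

End Products.

Section LieBialgebra.
Variable g : lmodType rat.
Variables (nabla : {linear tpow g 2 -> g}) (delta : {linear g -> ext g 2}).
Implicit Types X Y Z : g.

Definition bracket X Y : g := nabla (tens [tuple X; Y]).

(* Bilinearity of the bracket is the linearity of nabla. *)
Definition lie_algebra : Prop :=
  (forall X, bracket X X = 0) /\
  (forall X Y Z, bracket X (bracket Y Z) + bracket Y (bracket Z X) +
                 bracket Z (bracket X Y) = 0).

Definition sigma (p : nat) (Y : g) : ext g p -> ext g p :=
  extlift (fun X : p.-tuple g =>
    \sum_(i < p) wedge (set_entry X i (bracket Y (tnth X i)))).

(* In the sum lift j i is the index i, because i < j, and omit i (omit j X) drops
   the entries i and j of X.  Counting from 0 does not change the parity of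
   i + j.  The formula is alternating because nabla is: see [bdry_wedge]. *)
Definition bdry (p : nat) : ext g p.+1 -> ext g p :=
  match p with
  | 0 => fun=> 0
  | q.+1 => extlift (fun X : q.+2.-tuple g =>
      \sum_(j < q.+2) \sum_(i < q.+1 | (i < j)%N) (-1) ^+ (i + j) *:
        wedge [tuple of bracket (tnth X (lift j i)) (tnth X j) ::
                        omit i (omit j X)])
  end.

(* The index i is zero-based, hence the exponent i.+1. *)
Definition dext (p : nat) : ext g p -> ext g p.+1 :=
  match p with
  | 0 => fun=> 0
  | q.+1 => extlift (fun X : q.+1.-tuple g =>
      \sum_(i < q.+1) (-1) ^+ i.+1 *:
        ext_mul (delta (tnth X i)) (wedge (omit i X)))
  end.

Definition cycle3 : 'S_3 := perm (@ordS_inj 3).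

Definition cyclic_sum (x : tpow g 3) : tpow g 3 :=
  x + tpact cycle3 x + tpact (cycle3 * cycle3)%g x.

Definition delta_tens1 : tpow g 2 -> tpow g 3 :=
  tlift (fun X : 2.-tuple g =>
    tmul (ext_val (delta (tnth X 0))) (tens [tuple tnth X 1])).

Definition lie_coalgebra : Prop :=
  forall X, cyclic_sum (delta_tens1 (ext_val (delta X))) = 0.

Definition lie_bialgebra : Prop :=
  [/\ lie_algebra, lie_coalgebra &
      forall X Y, delta (bracket X Y) =
                  sigma X (delta Y) - sigma Y (delta X)].

Definition involutive_lie_bialgebra : Prop :=
  lie_bialgebra /\ forall X, nabla (ext_val (delta X)) = 0.

(* The direct sum of the exterior powers is the set of finitely supported
   families; the boundary of the degree 0 component contributes nothing. *)
Definition finitely_supported (x : forall p, ext g p) : Prop :=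
  exists n, forall p, (n <= p)%N -> x p = 0.

Definition total_bdry (x : forall p, ext g p) (p : nat) : ext g p :=
  bdry (x p.+1).

Definition total_dext (x : forall p, ext g p) (p : nat) : ext g p :=
  match p with
  | 0 => 0
  | q.+1 => dext (x q)
  end.

Lemma delta_tens1_tens (X Y : g) :
  delta_tens1 (tens [tuple X; Y]) = tmul (ext_val (delta X)) (tens [tuple Y]).
Proof.
rewrite /delta_tens1 tlift_tens // => Z i a x y.
have [->|->] : i = 0 \/ i = 1.
  by case: i => -[|[|//]] ?; [left|right]; apply: val_inj.
- rewrite !tnth_mktuple /= linearP -[ext_val (_ + _)]/(val _) linearP /=.
  exact: tmul_linear_l.
- rewrite !tnth_mktuple /=.
  have S1 z : [tuple z] = set_entry [tuple 0] 0 z :> 1.-tuple g.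
    by apply: eq_from_tnth => j; rewrite tnth_mktuple (ord1 j) tnth0.
  by rewrite ![tens [tuple _]](congr1 (@tens g 1) (S1 _)) tens_multilinear
             tmul_linear_r.
Qed.

Lemma bracket_linear_l Y : linear (bracket^~ Y).
Proof.
move=> a x y; rewrite /bracket.
have S z : [tuple z; Y] = set_entry [tuple 0; Y] 0 z.
  by apply/eqP; rewrite eqEtuple; apply/forallP=> -[[|[|//]] ?];
     rewrite !tnth_mktuple.
by rewrite (S (_ + _)) tens_multilinear linearP -!S.
Qed.

Lemma bracket_linear_r X : linear (bracket X).
Proof.
move=> a x y; rewrite /bracket.
have S z : [tuple X; z] = set_entry [tuple X; 0] 1 z.
  by apply/eqP; rewrite eqEtuple; apply/forallP=> -[[|[|//]] ?];
     rewrite !tnth_mktuple.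
by rewrite (S (_ + _)) tens_multilinear linearP -!S.
Qed.

Lemma bracketC X Y : lie_algebra -> bracket X Y = - bracket Y X.
Proof.
case=> b0 _; have := b0 (1 *: X + Y).
rewrite bracket_linear_l !bracket_linear_r !b0 scaler0 add0r addr0 !scale1r.
by move=> /eqP; rewrite addr_eq0 => /eqP.
Qed.

Lemma set_entry_same p (X : p.-tuple g) i x y :
  set_entry (set_entry X i x) i y = set_entry X i y.
Proof.
by apply: eq_from_tnth => j; rewrite !tnth_mktuple; case: eqP.
Qed.

Lemma set_entryC p (X : p.-tuple g) i j x y : i != j ->
  set_entry (set_entry X i x) j y = set_entry (set_entry X j y) i x.
Proof.
move=> ij; apply: eq_from_tnth => k; rewrite !tnth_mktuple.
by case: eqP => // ->; rewrite eq_sym (negPf ij).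
Qed.

Lemma omit_set_eq p (X : p.+1.-tuple g) i x :
  omit i (set_entry X i x) = omit i X.
Proof.
by apply: eq_from_tnth => k; rewrite !tnth_mktuple eq_sym (negPf (neq_lift _ _)).
Qed.

Lemma omit_set_lift p (X : p.+1.-tuple g) i k x :
  omit i (set_entry X (lift i k) x) = set_entry (omit i X) k x.
Proof.
by apply: eq_from_tnth => j; rewrite !tnth_mktuple (inj_eq lift_inj).
Qed.

Lemma cons_set_head p (Z : p.-tuple g) x y :
  [tuple of x :: Z] = set_entry [tuple of y :: Z] ord0 x.
Proof.
apply: eq_from_tnth => j; rewrite tnth_mktuple.
by case: (unliftP ord0 j) => [k|] ->; rewrite ?tnthS ?tnth0.
Qed.

Lemma cons_set_tail p (Z : p.-tuple g) x y k :
  [tuple of x :: set_entry Z k y] =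
  set_entry [tuple of x :: Z] (lift ord0 k) y.
Proof.
apply: eq_from_tnth => j; rewrite tnth_mktuple.
by case: (unliftP ord0 j) => [l|] ->; rewrite ?tnthS ?tnth0 ?tnth_mktuple.
Qed.

Lemma cons_permute p (Z : p.-tuple g) x s :
  [tuple of x :: permute s Z] =
  permute (lift_perm ord0 ord0 s) [tuple of x :: Z].
Proof.
apply: eq_from_tnth => j; rewrite tnth_mktuple.
case: (unliftP ord0 j) => [l|] ->; rewrite ?lift_perm_id ?lift_perm_lift.
  by rewrite !tnthS tnth_mktuple.
by rewrite !tnth0.
Qed.

Lemma wedge_cons_linear p (Z : p.-tuple g) :
  linear (fun x => wedge [tuple of x :: Z]).
Proof.
move=> a x y; rewrite (cons_set_head _ _ 0) wedge_multilinear.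
by rewrite -!cons_set_head.
Qed.

Lemma wedge_consZ p a x (Z : p.-tuple g) :
  wedge [tuple of (a *: x) :: Z] = a *: wedge [tuple of x :: Z].
Proof. exact: (linearZ_LR (linear_of (wedge_cons_linear Z))). Qed.

Lemma wedge_cons_multilinear p x :
  multilinear (fun Z : p.-tuple g => wedge [tuple of x :: Z]).
Proof. by move=> Z i a y z; rewrite !cons_set_tail wedge_multilinear. Qed.

Lemma wedge_cons_permute p (Z : p.-tuple g) x s :
  wedge [tuple of x :: permute s Z] = (-1) ^+ s *: wedge [tuple of x :: Z].
Proof.
by rewrite cons_permute wedge_alternating odd_lift_perm addFb.
Qed.

Lemma multilinear_omit (W : lmodType rat) p i (F : g -> p.-tuple g -> W) :
  (forall T, linear (F^~ T)) -> (forall x, multilinear (F x)) ->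
  multilinear (fun T => F (tnth T i) (omit i T)).
Proof.
move=> Fl Fm X k a x y; rewrite !tnth_mktuple.
case: (unliftP i k) => [l|] ->; last by rewrite eqxx !omit_set_eq Fl.
by rewrite (negPf (neq_lift _ _)) !omit_set_lift Fm.
Qed.

Lemma perm_lift p (s : 'S_p.+1) j :
  exists t : 'S_p, s = lift_perm j (s j) t.
Proof.
have H k : {l | s (lift j k) = lift (s j) l}.
  case: (unliftP (s j) (s (lift j k))) => [l ->|/perm_inj /eqP]; first by exists l.
  by rewrite eq_sym (negPf (neq_lift _ _)).
have t_inj : injective (fun k => sval (H k)).
  move=> k k' /(congr1 (lift (s j))).
  by rewrite -(svalP (H k)) -(svalP (H k')) => /perm_inj/lift_inj.
exists (perm t_inj); apply/perm.permP => k.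
case: (unliftP j k) => [l|] ->; rewrite ?lift_perm_id // lift_perm_lift permE.
by rewrite -(svalP (H l)).
Qed.

Lemma omit_permute p i j (t : 'S_p) (X : p.+1.-tuple g) :
  omit i (permute (lift_perm i j t) X) = permute t (omit j X).
Proof.
by apply: eq_from_tnth => k; rewrite !tnth_mktuple lift_perm_lift.
Qed.

Lemma sign_lift_perm p i j (t : 'S_p) :
  (-1) ^+ lift_perm i j t = (-1) ^+ (i + j) * (-1) ^+ t :> rat.
Proof. by rewrite odd_lift_perm -oddD signr_addb signr_odd. Qed.

Section Sigma.
Variables (p : nat) (Y : g).

Fact sigma_multilinear : multilinear (fun X : p.-tuple g =>
    \sum_(i < p) wedge (set_entry X i (bracket Y (tnth X i)))).
Proof.
apply: multilinear_sum => i _ X k a x y; rewrite !tnth_mktuple.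
have [->|ik] := eqVneq i k.
  by rewrite !set_entry_same bracket_linear_r wedge_multilinear.
by rewrite !(set_entryC _ _ _ (_ : k != i)) 1?eq_sym // wedge_multilinear.
Qed.

Fact sigma_alternating : alternating (fun X : p.-tuple g =>
    \sum_(i < p) wedge (set_entry X i (bracket Y (tnth X i)))).
Proof.
move=> s X; rewrite scaler_sumr [RHS](reindex_inj (@perm_inj _ s)) /=.
apply: eq_bigr => i _; rewrite tnth_mktuple -wedge_alternating permute_set.
by rewrite permK.
Qed.

Lemma sigma_linear : linear (@sigma p Y).
Proof. exact/extlift_linear/sigma_multilinear. Qed.

Lemma sigma_wedge (X : p.-tuple g) :
  sigma Y (wedge X) =
  \sum_(i < p) wedge (set_entry X i (bracket Y (tnth X i))).
Proof.
exact: (extlift_wedge _ sigma_multilinear sigma_alternating).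
Qed.
End Sigma.

Section Dext.
Variable q : nat.

Fact dext_multilinear : multilinear (fun X : q.+1.-tuple g =>
  \sum_(i < q.+1) (-1) ^+ i.+1 *:
    ext_mul (delta (tnth X i)) (wedge (omit i X))).
Proof.
apply: multilinear_sum => i _; apply: multilinear_scale.
apply: (@multilinear_omit (ext g (2 + q)) q i
  (fun x T => ext_mul (delta x) (wedge T))).
  by move=> Z a x y; rewrite linearP ext_mul_linear_l.
by move=> x Z k a y z; rewrite wedge_multilinear ext_mul_linear_r.
Qed.

Fact dext_alternating : alternating (fun X : q.+1.-tuple g =>
  \sum_(i < q.+1) (-1) ^+ i.+1 *:
    ext_mul (delta (tnth X i)) (wedge (omit i X))).
Proof.
move=> s X; rewrite scaler_sumr [RHS](reindex_inj (@perm_inj _ s)) /=.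
apply: eq_bigr => i _; rewrite tnth_mktuple.
have [t st] := perm_lift s i; rewrite [in omit i _]st omit_permute.
have := sign_lift_perm i (s i) t; rewrite -st => ->.
rewrite wedge_alternating ext_mulZr [LHS]scalerA [RHS]scalerA; congr (_ *: _).
rewrite [RHS]mulrAC -[in RHS]exprD.
have -> : (i + s i + (s i).+1 = i.+1 + 2 * s i)%N.
  by lia.
by rewrite exprD exprM sqrrN !expr1n mulr1.
Qed.

Lemma dext_wedge (X : q.+1.-tuple g) :
  dext (wedge X) = \sum_(i < q.+1) (-1) ^+ i.+1 *:
    ext_mul (delta (tnth X i)) (wedge (omit i X)).
Proof. exact: (extlift_wedge _ dext_multilinear dext_alternating). Qed.
End Dext.

Lemma dext_linear p : linear (@dext p).
Proof.
case: p => [|q]; first by move=> a x y; rewrite scaler0 addr0.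
exact/extlift_linear/dext_multilinear.
Qed.

Lemma dext_wedge1 X : dext (wedge [tuple X]) = - delta X.
Proof.
rewrite dext_wedge big_ord1 expr1 scaleN1r; congr (- _).
have -> : wedge (omit ord0 [tuple X]) = wedge [tuple] by congr wedge; apply: tuple0.
pose h := linear_of (ext_mul_linear_l (p := 2) (wedge ([tuple] : 0.-tuple g))).
suff E T : h (wedge T) = wedge T.
  exact: (ext_ext (h := h) (k := idfun) E).
rewrite /h /= ext_mul_wedge; congr wedge.
by apply: val_inj; rewrite /= cats0.
Qed.

Section Bdry.
Variable q : nat.
Implicit Types (T : q.+2.-tuple g) (c : 'I_q.+2 * 'I_q.+1).

Let bdry_term T c : ext g q.+1 :=
  (-1) ^+ (c.2 + c.1) *:
    wedge [tuple of bracket (tnth T (lift c.1 c.2)) (tnth T c.1) ::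
                    omit c.2 (omit c.1 T)].

Let bdry_fun T : ext g q.+1 :=
  \sum_(j < q.+2) \sum_(i < q.+1 | (i < j)%N) (-1) ^+ (i + j) *:
    wedge [tuple of bracket (tnth T (lift j i)) (tnth T j) ::
                    omit i (omit j T)].

Fact bdry_multilinear : multilinear bdry_fun.
Proof.
apply: multilinear_sum => j _; apply: multilinear_sum => i _.
apply: multilinear_scale.
pose F (y : g) (T : q.+1.-tuple g) : ext g q.+1 :=
  wedge [tuple of bracket (tnth T i) y :: omit i T].
have E T : wedge [tuple of bracket (tnth T (lift j i)) (tnth T j) ::
                           omit i (omit j T)] = F (tnth T j) (omit j T).
  by rewrite /F tnth_mktuple.
suff mF : multilinear (fun T => F (tnth T j) (omit j T)).
  by move=> T k a x y; rewrite !E mF.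
apply: multilinear_omit => [T a x y|y].
  by rewrite /F bracket_linear_r wedge_cons_linear.
apply: (@multilinear_omit _ _ _
          (fun x (U : q.-tuple g) => wedge [tuple of bracket x y :: U])).
  by move=> U a x z; rewrite bracket_linear_l wedge_cons_linear.
by move=> x; apply: wedge_cons_multilinear.
Qed.

Hypothesis lie : lie_algebra.

Let swap c : 'I_q.+2 * 'I_q.+1 :=
  (lift c.1 c.2, odflt c.2 (unlift (lift c.1 c.2) c.1)).

Let lift_swap c : lift (swap c).1 (swap c).2 = c.1.
Proof.
rewrite /swap /=; case: unliftP => [k <- //|] /eqP.
by rewrite (negPf (neq_lift _ _)).
Qed.

Let swapK : ssrfun.involutive swap.
Proof.
move=> c; have e1 : (swap (swap c)).1 = c.1 by apply: lift_swap.
have := lift_swap (swap c); rewrite e1 => /(@lift_inj _ c.1) e2.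
by rewrite [LHS]surjective_pairing e1 e2 -surjective_pairing.
Qed.

Let swap_val c : (swap c).2 = (if (c.2 < c.1)%N then c.1.-1 else c.1) :> nat.
Proof.
have : bump (bump c.1 c.2) (swap c).2 = c.1 by exact: (congr1 (@nat_of_ord _) (lift_swap c)).
by move: (nat_of_ord (swap c).2) => k; rewrite /bump; case: (ltnP c.2 c.1); lia.
Qed.

Let swap_val1 c : (swap c).1 = bump c.1 c.2 :> nat.
Proof. by []. Qed.

Let swap_lt c : ((swap c).2 < (swap c).1)%N = ~~ (c.2 < c.1)%N.
Proof. by rewrite swap_val swap_val1 /bump; case: (ltnP c.2 c.1); lia. Qed.

Let bdry_term_swap T c : bdry_term T (swap c) = bdry_term T c.
Proof.
rewrite /bdry_term lift_swap bracketC //.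
have -> : omit (swap c).2 (omit (swap c).1 T) = omit c.2 (omit c.1 T).
  apply: eq_from_tnth => k; rewrite !tnth_mktuple; congr (tnth T _).
  apply: val_inj; rewrite [LHS]/= swap_val /= /bump.
  by case: (ltnP c.2 c.1); lia.
rewrite -scaleN1r wedge_consZ scalerA; congr (_ *: _).
have : odd ((swap c).2 + (swap c).1) = ~~ odd (c.2 + c.1).
  by rewrite swap_val swap_val1 /bump; case: (ltnP c.2 c.1); lia.
by rewrite -signr_odd => ->; rewrite -[in RHS]signr_odd signrN mulrN1 opprK.
Qed.

Let bdry_fun_double T : \sum_c bdry_term T c = 2%:R *: bdry_fun T.
Proof.
rewrite (bigID (fun c => c.2 < c.1)%N) /= scaler_nat mulr2n; congr (_ + _).
  by rewrite /bdry_fun pair_big_dep.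
rewrite (reindex_inj (inv_inj swapK)) /= /bdry_fun pair_big_dep /=.
apply: eq_big => c; first by rewrite swap_lt negbK.
by rewrite bdry_term_swap.
Qed.

Fact bdry_alternating : alternating bdry_fun.
Proof.
move=> s T.
suff: 2%:R *: bdry_fun (permute s T) = 2%:R *: ((-1) ^+ s *: bdry_fun T).
  move/(congr1 (fun w => (2%:R)^-1 *: w)).
  by rewrite [LHS]scalerA [RHS]scalerA mulVf // !scale1r.
rewrite -bdry_fun_double scalerA mulrC -scalerA -bdry_fun_double.
rewrite -!(pair_bigA _ (fun j i => bdry_term _ (j, i))) scaler_sumr /=.
rewrite [RHS](reindex_inj (@perm_inj _ s)) /=.
apply: eq_bigr => j _; have [t st] := perm_lift s j.
rewrite scaler_sumr [RHS](reindex_inj (@perm_inj _ t)) /=.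
apply: eq_bigr => i _; have [u tu] := perm_lift t i.
have e1 : omit i (omit j (permute s T)) =
          permute u (omit (t i) (omit (s j) T)).
  by rewrite {1}st omit_permute {1}tu omit_permute.
have e2 : tnth (permute s T) (lift j i) = tnth T (lift (s j) (t i)).
  by rewrite tnth_mktuple {1}st lift_perm_lift.
have e3 : tnth (permute s T) j = tnth T (s j) by rewrite tnth_mktuple.
rewrite [bdry_term (permute s T) _]/bdry_term e1 e2 e3 wedge_cons_permute.
rewrite [LHS]scalerA [RHS]scalerA; congr (_ *: _).
have := sign_lift_perm j (s j) t; rewrite -st => ->.
have := sign_lift_perm i (t i) u; rewrite -tu => ->.
rewrite -!exprD /=.
have -> : (j + s j + (i + t i + u) + (t i + s j) =
           i + j + u + 2 * (s j + t i))%N by lia.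
by rewrite [RHS]exprD exprM sqrrN !expr1n mulr1.
Qed.

Lemma bdry_wedge T :
  bdry (wedge T) =
  \sum_(j < q.+2) \sum_(i < q.+1 | (i < j)%N) (-1) ^+ (i + j) *:
    wedge [tuple of bracket (tnth T (lift j i)) (tnth T j) ::
                    omit i (omit j T)].
Proof. exact: (extlift_wedge _ bdry_multilinear bdry_alternating). Qed.
End Bdry.

Lemma bdry_linear p : linear (@bdry p).
Proof.
case: p => [|q]; first by move=> a x y; rewrite scaler0 addr0.
exact/extlift_linear/bdry_multilinear.
Qed.

Lemma total_bdry_finite x :
  finitely_supported x -> finitely_supported (total_bdry x).
Proof.
case=> n xn; exists n => p np; rewrite /total_bdry xn 1?leqW //.
exact: (linear0 (linear_of (@bdry_linear p))).
Qed.

Lemma total_dext_finite x :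
  finitely_supported x -> finitely_supported (total_dext x).
Proof.
case=> n xn; exists n.+1 => -[//|p] np; rewrite /= xn //.
exact: (linear0 (linear_of (@dext_linear p))).
Qed.

End LieBialgebra.

(* Main.v *)
(* Write L_X for left wedging by X and D_u for left wedging by u in Lambda^2.
   Three recursions determine all operators on Lambda^*:
     d L_X = - D_(delta X) - L_X d,    del L_X = - sigma(X) - L_X del,
     sigma(Y) L_X = L_[Y,X] + L_X sigma(Y).
   They show that the defects d D_u - D_u d, D_u del - del D_u and, with
   u = delta X,
     E_X = [sigma(X), d] + D_u del - del D_u
   anticommute with every L_Y, up to a wedge product with, respectively,
   0, sigma(Y) u and delta[X,Y] - sigma(X)(delta Y) + sigma(Y)(delta X).
   Since d d L_X = L_X d d - (d D_(delta X) - D_(delta X) d) and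
   (d del + del d) L_X = L_X (d del + del d) + E_X, both equations on Lambda^*
   follow by induction from low degrees, where d d = 0 on Lambda^1 is coJacobi,
   d del + del d = 0 on Lambda^1 is involutivity, and the same equation on
   Lambda^2 is then the compatibility condition. *)
From HB Require Import structures.
From mathcomp Require Import all_fingroup.
Require Import Defs.
From mathcomp Require Import all_boot all_order all_algebra.
From mathcomp Require Import zify.

Set Implicit Arguments.
Unset Strict Implicit.
Unset Printing Implicit Defensive.

Import GRing.Theory.
Local Open Scope ring_scope.

(** * Closure properties of linear maps *)

Section LinearClosure.
Variables U V W : lmodType rat.
Implicit Types f h : U -> V.

Lemma linear_add f h : linear f -> linear h -> linear (fun x => f x + h x).
Proof. by move=> lf lh a x y; rewrite lf lh scalerDr addrACA. Qed.

Lemma linear_opp f : linear f -> linear (fun x => - f x).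
Proof. by move=> lf a x y; rewrite lf opprD scalerN. Qed.

Lemma linear_comp (k : V -> W) f :
  linear k -> linear f -> linear (fun x => k (f x)).
Proof. by move=> lk lf a x y; rewrite lf lk. Qed.

End LinearClosure.

(* Locked because otherwise unification unfolds the wedge products, which makes
   rewriting with [wedge1C] extremely slow. *)
HB.lock Definition wedge1 (V : lmodType rat) (p : nat) (X : V) (w : ext V p) :
  ext V p.+1 := @ext_mul V 1 p (wedge [tuple X]) w.

HB.lock Definition wedge2 (V : lmodType rat) (p : nat) (u : ext V 2)
  (w : ext V p) : ext V p.+2 := @ext_mul V 2 p u w.

(** * Left wedging by a vector and by an element of Lambda^2 *)

Section LeftWedge.
Variable V : lmodType rat.

(** Linearity is a hypothesis here because many maps compared below, such as [fun u => wedge2 u w],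
    carry no bundled linear structure. *)
Lemma ext_eq (W : lmodType rat) p (h k : ext V p -> W) :
  linear h -> linear k -> (forall X, h (wedge X) = k (wedge X)) -> h =1 k.
Proof.
by move=> lh lk; apply: (ext_ext (h := linear_of lh) (k := linear_of lk)).
Qed.

Lemma wedge1_wedge p X (Z : p.-tuple V) :
  wedge1 X (wedge Z) = wedge [tuple of X :: Z].
Proof. by rewrite wedge1.unlock ext_mul_wedge; congr wedge; apply: val_inj. Qed.

Lemma wedge1_linear p X : linear (@wedge1 V p X).
Proof. by rewrite wedge1.unlock; apply: (@ext_mul_linear_r V 1 p). Qed.

Lemma wedge2_linear p u : linear (@wedge2 V p u).
Proof. by rewrite wedge2.unlock; apply: (@ext_mul_linear_r V 2 p). Qed.

HB.instance Definition _ p X := GRing.isLinear.Build rat (ext V p) (ext V p.+1)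
  *:%R (@wedge1 V p X) (@wedge1_linear p X).
HB.instance Definition _ p u := GRing.isLinear.Build rat (ext V p) (ext V p.+2)
  *:%R (@wedge2 V p u) (@wedge2_linear p u).

Lemma wedge1_linear_l p (w : ext V p) : linear (fun X => wedge1 X w).
Proof.
move=> a x y; have S z : [tuple z] = set_entry [tuple 0] 0 z :> 1.-tuple V.
  by apply: eq_from_tnth => j; rewrite tnth_mktuple (ord1 j) tnth0.
rewrite wedge1.unlock (S (_ + _)) wedge_multilinear -!S.
exact: (@ext_mul_linear_l V 1 p).
Qed.

Lemma wedge2_linear_l p (w : ext V p) : linear (fun u => wedge2 u w).
Proof. by rewrite wedge2.unlock; apply: (@ext_mul_linear_l V 2 p). Qed.

Lemma wedge1Z p a X (w : ext V p) : wedge1 X (a *: w) = a *: wedge1 X w.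
Proof. exact: linearZ. Qed.

Lemma wedge1_sum p X (I : Type) (r : seq I) (P : pred I) (F : I -> ext V p) :
  wedge1 X (\sum_(i <- r | P i) F i) = \sum_(i <- r | P i) wedge1 X (F i).
Proof. exact: linear_sum. Qed.

Lemma wedge1D p X (v w : ext V p) : wedge1 X (v + w) = wedge1 X v + wedge1 X w.
Proof. exact: linearD. Qed.

Lemma wedge1N p X (w : ext V p) : wedge1 X (- w) = - wedge1 X w.
Proof. exact: linearN. Qed.

Lemma wedge1_0 p X : wedge1 X (0 : ext V p) = 0.
Proof. exact: linear0. Qed.

Lemma wedge2_0 p u : wedge2 u (0 : ext V p) = 0.
Proof. exact: linear0. Qed.

Lemma wedge1_0l p (w : ext V p) : wedge1 0 w = 0.
Proof. exact: (linear0 (linear_of (wedge1_linear_l w))). Qed.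

Lemma wedge1Dl p X Y (w : ext V p) : wedge1 (X + Y) w = wedge1 X w + wedge1 Y w.
Proof. exact: (linearD (linear_of (wedge1_linear_l w))). Qed.

Lemma wedge1Nl p X (w : ext V p) : wedge1 (- X) w = - wedge1 X w.
Proof. exact: (linearN (linear_of (wedge1_linear_l w))). Qed.

Lemma wedge2Dl p u v (w : ext V p) : wedge2 (u + v) w = wedge2 u w + wedge2 v w.
Proof. exact: (linearD (linear_of (wedge2_linear_l w))). Qed.

Lemma wedge2Nl p u (w : ext V p) : wedge2 (- u) w = - wedge2 u w.
Proof. exact: (linearN (linear_of (wedge2_linear_l w))). Qed.

Lemma wedge2_0l p (w : ext V p) : wedge2 0 w = 0.
Proof. exact: (linear0 (linear_of (wedge2_linear_l w))). Qed.

(** Associativity of the wedge product. Together with [ext_eq2] it reduces statements about D_u to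
    left wedging by vectors. *)
Lemma wedge2_wedge p X Y (w : ext V p) :
  wedge2 (wedge [tuple X; Y]) w = wedge1 X (wedge1 Y w).
Proof.
move: w; apply: ext_eq; first exact: wedge2_linear.
  exact/linear_comp/wedge1_linear/wedge1_linear.
move=> Z; rewrite !wedge1_wedge wedge2.unlock ext_mul_wedge; congr wedge.
exact: val_inj.
Qed.

Lemma wedge2_1 (u : ext V 2) : wedge2 u (wedge [tuple]) = u.
Proof.
move: u; apply: ext_eq => //; first exact: wedge2_linear_l.
move=> Z; rewrite wedge2.unlock ext_mul_wedge; congr wedge.
by apply: val_inj; rewrite /= cats0.
Qed.

Lemma tuple_cons p (Z : p.+1.-tuple V) :
  Z = [tuple of thead Z :: behead_tuple Z].
Proof. by rewrite {1}[Z]tuple_eta; apply: val_inj. Qed.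

(** The induction step for operators on Lambda^*: the products X /\ w span, and [w] may be any
    element, not only a decomposable one. *)
Lemma ext_eqS (W : lmodType rat) p (h k : ext V p.+1 -> W) :
  linear h -> linear k ->
  (forall X w, h (wedge1 X w) = k (wedge1 X w)) -> h =1 k.
Proof.
move=> lh lk hk; apply: ext_eq => // Z.
by rewrite [Z]tuple_cons -wedge1_wedge hk.
Qed.

Lemma ext_eq0 (W : lmodType rat) (h k : ext V 0 -> W) :
  linear h -> linear k -> h (wedge [tuple]) = k (wedge [tuple]) -> h =1 k.
Proof. by move=> lh lk hk; apply: ext_eq => // Z; rewrite tuple0. Qed.

Lemma ext_eq2 (W : lmodType rat) (h k : ext V 2 -> W) :
  linear h -> linear k ->
  (forall X Y, h (wedge [tuple X; Y]) = k (wedge [tuple X; Y])) -> h =1 k.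
Proof.
move=> lh lk hk; apply: ext_eq => // -[[|X [|Y [|]]]] // sZ.
have -> : Tuple sZ = [tuple X; Y] by apply: val_inj.
exact: hk.
Qed.

(** Bringing entry [j] to the front while keeping the order of the others is a cycle of sign (-1)^j.
    This matches the terms of [sigma] with those of the boundary. *)
Lemma wedge_set_entry p (Z : p.+1.-tuple V) j y :
  wedge (set_entry Z j y) = (-1) ^+ j *: wedge1 y (wedge (omit j Z)).
Proof.
rewrite wedge1_wedge.
have -> : [tuple of y :: omit j Z] =
          permute (lift_perm ord0 j 1) (set_entry Z j y).
  apply: eq_from_tnth => i; rewrite !tnth_mktuple.
  case: (unliftP ord0 i) => [k|] ->.
    rewrite tnthS lift_perm_lift perm1 tnth_mktuple.
    by rewrite eq_sym (negPf (neq_lift _ _)).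
  by rewrite tnth0 lift_perm_id eqxx.
rewrite wedge_alternating odd_lift_perm odd_perm1 addbF /= signr_odd.
by rewrite scalerA -exprMn mulrNN mulr1 expr1n scale1r.
Qed.

Lemma wedge1C p X Y (w : ext V p) :
  wedge1 X (wedge1 Y w) = - wedge1 Y (wedge1 X w).
Proof.
move: w; apply: ext_eq.
- exact/linear_comp/wedge1_linear/wedge1_linear.
- exact/linear_opp/linear_comp/wedge1_linear/wedge1_linear.
move=> Z; rewrite !wedge1_wedge.
set T := [tuple of Y :: [tuple of X :: Z]].
have -> : [tuple of X :: [tuple of Y :: Z]] =
          permute (tperm ord0 (lift ord0 ord0)) T.
  apply: eq_from_tnth => i; rewrite tnth_mktuple.
  case: (unliftP ord0 i) => [k|] ->; last by rewrite tpermL tnthS !tnth0.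
  case: (unliftP ord0 k) => [l|] ->; last by rewrite tpermR tnthS !tnth0.
  by rewrite tpermD ?neq_lift ?(inj_eq lift_inj) ?neq_lift // !tnthS.
by rewrite wedge_alternating odd_tperm neq_lift expr1 scaleN1r.
Qed.

(** The vector passes two factors, and the two signs cancel. *)
Lemma wedge2_wedge1 p u X (w : ext V p) :
  wedge2 u (wedge1 X w) = wedge1 X (wedge2 u w).
Proof.
move: u; apply: ext_eq2; first exact: wedge2_linear_l.
  exact/linear_comp/wedge2_linear_l/wedge1_linear.
by move=> a b; rewrite !wedge2_wedge (wedge1C b) wedge1N wedge1C opprK.
Qed.

End LeftWedge.

(** * The recursions for [dext], [sigma] and [bdry] along left wedging *)

Section Operators.
Variables (g : lmodType rat) (nabla : {linear tpow g 2 -> g}).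
Variable delta : {linear g -> ext g 2}.

Local Notation br := (bracket nabla).
Local Notation d := (dext delta).
Local Notation b := (bdry nabla).
Local Notation s := (sigma nabla).

HB.instance Definition _ p := GRing.isLinear.Build rat (ext g p) (ext g p.+1)
  *:%R (@dext g delta p) (dext_linear delta (p := p)).
HB.instance Definition _ p := GRing.isLinear.Build rat (ext g p.+1) (ext g p)
  *:%R (@bdry g nabla p) (bdry_linear nabla (p := p)).
HB.instance Definition _ p Y := GRing.isLinear.Build rat (ext g p) (ext g p)
  *:%R (@sigma g nabla p Y) (sigma_linear nabla (p := p) Y).

Lemma tuple_omit0 p X (Z : p.-tuple g) : omit ord0 [tuple of X :: Z] = Z.
Proof. by apply: eq_from_tnth => i; rewrite tnth_mktuple tnthS. Qed.

Lemma lift_lift0 p (i : 'I_p.+1) : lift (lift ord0 i) ord0 = ord0.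
Proof. exact: val_inj. Qed.

Lemma lift_liftS p (i : 'I_p.+1) (k : 'I_p) :
  lift (lift ord0 i) (lift ord0 k) = lift ord0 (lift i k).
Proof. by apply: val_inj; rewrite /= /bump; lia. Qed.

Lemma tuple_omitS p X (Z : p.+1.-tuple g) i :
  omit (lift ord0 i) [tuple of X :: Z] = [tuple of X :: omit i Z].
Proof.
apply: eq_from_tnth => j; rewrite tnth_mktuple.
case: (unliftP ord0 j) => [k|] ->; last by rewrite lift_lift0 !tnth0.
by rewrite lift_liftS !tnthS tnth_mktuple.
Qed.

(** The term of index 0 is - delta X /\ w. In the others [X] passes an even element without a sign,
    and the shift of the index by one gives the minus. *)
Lemma wedge1_dext p X (w : ext g p) :
  d (wedge1 X w) = - wedge2 (delta X) w - wedge1 X (d w).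
Proof.
move: w; apply: ext_eq.
- exact/linear_comp/wedge1_linear/dext_linear.
- apply: linear_add; first exact/linear_opp/wedge2_linear.
  exact/linear_opp/linear_comp/dext_linear/wedge1_linear.
move=> Z; rewrite wedge1_wedge dext_wedge big_ord_recl tnth0 tuple_omit0.
rewrite expr1 scaleN1r; congr (_ + _); first by rewrite wedge2.unlock.
case: p Z => [|p] Z; first by rewrite big_ord0 wedge1_0 oppr0.
rewrite dext_wedge wedge1_sum -sumrN; apply: eq_bigr => i _.
rewrite tnthS tuple_omitS -wedge1_wedge exprS mulN1r scaleNr.
rewrite wedge1Z; congr (- (_ *: _)).
move: (wedge2_wedge1 (delta (tnth Z i)) X (wedge (omit i Z))).
by rewrite wedge2.unlock.
Qed.

Lemma wedge1_sigma p X Y (w : ext g p) :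
  s Y (wedge1 X w) = wedge1 (br Y X) w + wedge1 X (s Y w).
Proof.
move: w; apply: ext_eq.
- exact/linear_comp/wedge1_linear/sigma_linear.
- apply: linear_add; first exact/wedge1_linear.
  exact/linear_comp/sigma_linear/wedge1_linear.
move=> Z; rewrite !wedge1_wedge !sigma_wedge big_ord_recl tnth0.
rewrite -(cons_set_head _ _ X); congr (_ + _).
rewrite wedge1_sum; apply: eq_bigr => i _.
by rewrite tnthS -cons_set_tail wedge1_wedge.
Qed.

Lemma sigma0 Y (w : ext g 0) : s Y w = 0.
Proof.
move: w; apply: ext_eq; first exact/sigma_linear.
  by move=> a x y; rewrite scaler0 addr0.
by move=> Z; rewrite sigma_wedge big_ord0.
Qed.

Hypothesis lie_g : lie_algebra nabla.

(** Pairs containing position 0 add up to - sigma(X); in the other pairs both indices shift by one,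
    which keeps the sign. The outer [omit] is left unsimplified because [omit i (omit j Z)] would
    require [q] to be a successor. *)
Lemma bdry_cons q X (Z : q.+1.-tuple g) :
  b (wedge [tuple of X :: Z]) = - s X (wedge Z) +
  \sum_(j < q.+1) \sum_(i < q | (i < j)%N) (-1) ^+ (i + j) *:
    wedge [tuple of br (tnth Z (lift j i)) (tnth Z j) ::
             omit (lift ord0 i) [tuple of X :: omit j Z]].
Proof.
rewrite bdry_wedge // big_ord_recl big_pred0 => [|i]; last by rewrite ltn0.
rewrite add0r sigma_wedge -sumrN -big_split; apply: eq_bigr => j _.
(* The inner index 0 pairs [X] with entry [j] of [Z], which has position j + 1. *)
rewrite big_mkcond big_ord_recl; congr (_ + _).
  rewrite lift_lift0 tnth0 tnthS tuple_omitS tuple_omit0.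
  rewrite wedge_set_entry wedge1_wedge.
  by rewrite add0n lift0 exprS mulN1r scaleNr.
rewrite [RHS]big_mkcond; apply: eq_bigr => i _.
rewrite -[(_ < lift _ _)%N]/(i < j)%N; case: ifP => // _.
rewrite lift_liftS !tnthS tuple_omitS /= /bump !add1n addnS addSn.
by rewrite !exprS mulrA mulrNN mulr1 mul1r.
Qed.

Lemma wedge1_bdry1 X (w : ext g 1) : b (wedge1 X w) = - s X w.
Proof.
move: w; apply: ext_eq; first exact/linear_comp/wedge1_linear/bdry_linear.
  exact/linear_opp/sigma_linear.
move=> Z; rewrite wedge1_wedge bdry_cons big1 ?addr0 // => j _.
by rewrite big_ord0.
Qed.

(** In the double sum of [bdry_cons], exchanging [X] with the leading bracket gives the minus sign.
    Elements of degree 1 are treated in [wedge1_bdry1], since [bdry] is defined by cases there. *)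
Lemma wedge1_bdry p X (w : ext g p.+2) :
  b (wedge1 X w) = - s X w - wedge1 X (b w).
Proof.
move: w; apply: ext_eq; first exact/linear_comp/wedge1_linear/bdry_linear.
  apply: linear_add; first exact/linear_opp/sigma_linear.
  exact/linear_opp/linear_comp/bdry_linear/wedge1_linear.
move=> Z; rewrite wedge1_wedge bdry_cons; congr (_ + _).
rewrite bdry_wedge // wedge1_sum -sumrN; apply: eq_bigr => j _.
rewrite wedge1_sum -sumrN; apply: eq_bigr => i _.
by rewrite wedge1Z tuple_omitS -!wedge1_wedge [in RHS]wedge1C scalerN opprK.
Qed.

(* Moves all terms to the left, then brings each pair [- t], [t] to the end of
   the sum, where it cancels. *)
Ltac zmod_cancel :=
  apply: subr0_eq; rewrite ?(opprD, opprK, oppr0, addr0, add0r, addrA);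
  rewrite -[LHS]add0r ?addrA;
  repeat match goal with |- context [- ?t] =>
    rewrite ?(addrAC _ (- t)) ?(addrAC _ t) subrK end;
  reflexivity.

Lemma sigmaD p X (v w : ext g p) : s X (v + w) = s X v + s X w.
Proof. exact: linearD. Qed.

Lemma sigmaN p X (w : ext g p) : s X (- w) = - s X w.
Proof. exact: linearN. Qed.

Lemma sigma_0 p X : s X (0 : ext g p) = 0.
Proof. exact: linear0. Qed.

Lemma dext0 (w : ext g 0) : d w = 0.
Proof. by []. Qed.

Lemma bdry_ext1 (w : ext g 1) : b w = 0.
Proof. by []. Qed.

Lemma dext_0 p : d (0 : ext g p) = 0.
Proof. exact: linear0. Qed.

Lemma dextD p (v w : ext g p) : d (v + w) = d v + d w.
Proof. exact: linearD. Qed.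

Lemma dextN p (w : ext g p) : d (- w) = - d w.
Proof. exact: linearN. Qed.

Lemma bdryD p (v w : ext g p.+1) : b (v + w) = b v + b w.
Proof. exact: linearD. Qed.

Lemma bdryN p (w : ext g p.+1) : b (- w) = - b w.
Proof. exact: linearN. Qed.

Lemma wedge1_0wedge (X : g) :
  wedge1 X (wedge ([tuple] : 0.-tuple g)) = wedge [tuple X].
Proof. by rewrite wedge1_wedge; congr wedge; apply: val_inj. Qed.

Lemma wedge1_1wedge (X Y : g) : wedge1 X (wedge [tuple Y]) = wedge [tuple X; Y].
Proof. by rewrite wedge1_wedge; congr wedge; apply: val_inj. Qed.

Lemma sigma_wedge2 Y x z :
  s Y (wedge [tuple x; z]) =
  wedge [tuple br Y x; z] + wedge [tuple x; br Y z].
Proof.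
rewrite -wedge1_1wedge -wedge1_0wedge 2!wedge1_sigma sigma0 wedge1_0 addr0.
by rewrite !wedge1_0wedge !wedge1_1wedge.
Qed.

Lemma wedge2_sigma p X u (w : ext g p) :
  s X (wedge2 u w) = wedge2 (s X u) w + wedge2 u (s X w).
Proof.
move: u; apply: ext_eq2.
- exact/linear_comp/wedge2_linear_l/sigma_linear.
- apply: linear_add; last exact: wedge2_linear_l.
  exact: (linear_comp (wedge2_linear_l w) (sigma_linear _ _)).
move=> x y; rewrite sigma_wedge2 wedge2Dl !wedge2_wedge !wedge1_sigma.
by rewrite wedge1D addrA.
Qed.

(** * Commutators with D_u, and the equation d d = 0 *)

Definition dext_defect (p : nat) (u : ext g 2) (w : ext g p) : ext g p.+3 :=
  d (wedge2 u w) - wedge2 u (d w).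

Lemma dext_defect_linear_l p (w : ext g p) : linear (fun u => dext_defect u w).
Proof.
apply: linear_add; first exact/linear_comp/wedge2_linear_l/dext_linear.
exact/linear_opp/wedge2_linear_l.
Qed.

Lemma dext_defect_linear p u : linear (@dext_defect p u).
Proof.
apply: linear_add; first exact/linear_comp/wedge2_linear/dext_linear.
exact/linear_opp/linear_comp/dext_linear/wedge2_linear.
Qed.

(** The terms in d w cancel, and what remains is left wedging by d u, written out for u = x /\ y. *)
Lemma dext_defect_wedge p x y (w : ext g p) :
  dext_defect (wedge [tuple x; y]) w =
  wedge1 x (wedge2 (delta y) w) - wedge1 y (wedge2 (delta x) w).
Proof.
rewrite /dext_defect !wedge2_wedge !wedge1_dext wedge2_wedge1.
by rewrite wedge1D !wedge1N opprD !opprK addrA addrK addrC.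
Qed.

(** The defect is left wedging by an element of degree 3, so passing [Y] changes the sign. *)
Lemma dext_defect_wedge1 p u Y (w : ext g p) :
  dext_defect u (wedge1 Y w) = - wedge1 Y (dext_defect u w).
Proof.
move: u; apply: ext_eq2; first exact: dext_defect_linear_l.
  exact/linear_opp/linear_comp/dext_defect_linear_l/wedge1_linear.
move=> x z; rewrite !dext_defect_wedge !wedge2_wedge1 wedge1D wedge1N.
by rewrite (wedge1C Y x) (wedge1C Y z) opprD !opprK.
Qed.

Lemma dext_defect0 u (w : ext g 0) : d u = 0 -> dext_defect u w = 0.
Proof.
move=> du; move: w; apply: ext_eq0; first exact: dext_defect_linear.
  by move=> a x y; rewrite scaler0 addr0.
by rewrite /dext_defect wedge2_0 wedge2_1 du subr0.
Qed.

Lemma dext_defect_eq0 p u (w : ext g p) : d u = 0 -> dext_defect u w = 0.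
Proof.
move=> du; elim: p w => [|p IH] w; first exact: dext_defect0.
move: w; apply: ext_eqS; first exact: dext_defect_linear.
  by move=> a x y; rewrite scaler0 addr0.
by move=> Y w; rewrite dext_defect_wedge1 IH wedge1_0 oppr0.
Qed.

Lemma dext_dext p (w : ext g p) :
  (forall X, d (delta X) = 0) -> d (d w) = 0.
Proof.
move=> dd; elim: p w => [|p IH] w; first by rewrite dext0 dext_0.
move: w; apply: ext_eqS; first exact/linear_comp/dext_linear/dext_linear.
  by move=> a x y; rewrite scaler0 addr0.
move=> X w; have := dext_defect_eq0 w (dd X); rewrite /dext_defect.
move=> /eqP; rewrite subr_eq0 => /eqP E.
by rewrite wedge1_dext dextD !dextN wedge1_dext IH wedge1_0 subr0 E opprK addNr.
Qed.

(* The first case is the second one with the boundary of degree 0 elements read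
   as 0. *)
Definition bdry_defect (p : nat) (u : ext g 2) : ext g p -> ext g p.+1 :=
  match p with
  | 0 => fun w => - b (wedge2 u w)
  | q.+1 => fun w => wedge2 u (b w) - b (wedge2 u w)
  end.

Lemma bdry_defect_linear_l p (w : ext g p) : linear (fun u => bdry_defect u w).
Proof.
case: p w => [|p] w.
  exact/linear_opp/linear_comp/wedge2_linear_l/bdry_linear.
apply: linear_add; first exact: wedge2_linear_l.
exact/linear_opp/linear_comp/wedge2_linear_l/bdry_linear.
Qed.

Lemma bdry_defect_linear p u : linear (@bdry_defect p u).
Proof.
case: p => [|p].
  exact/linear_opp/linear_comp/wedge2_linear/bdry_linear.
apply: linear_add; first exact/linear_comp/bdry_linear/wedge2_linear.
exact/linear_opp/linear_comp/wedge2_linear/bdry_linear.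
Qed.

(** The boundary is a differential operator of order two for the wedge product, so its commutator
    with D_u has order one: the terms x /\ y /\ del w cancel. *)
Lemma bdry_defect_wedge p x y (w : ext g p) :
  bdry_defect (wedge [tuple x; y]) w =
  wedge1 (br x y) w + wedge1 y (s x w) - wedge1 x (s y w).
Proof.
case: p w => [|p] w.
  rewrite /bdry_defect wedge2_wedge wedge1_bdry1 opprK wedge1_sigma.
  by rewrite !sigma0 !wedge1_0 subr0.
rewrite /bdry_defect !wedge2_wedge wedge1_bdry wedge1_sigma.
(* Degree 1 is apart because the recursion for [bdry] has no boundary term there. *)
case: p w => [|p] w.
  by rewrite wedge1_bdry1 wedge1N !opprD !opprK bdry_ext1 !wedge1_0 add0r.
rewrite wedge1_bdry wedge1D !wedge1N !opprD !opprK addrA.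
by zmod_cancel.
Qed.

(** For u = x /\ z the Leibniz rule for [sigma] leaves the extra factor z /\ [x,Y] - x /\ [z,Y],
    which is sigma(Y) u by antisymmetry of the bracket. *)
Lemma bdry_defect_wedge1 p u Y (w : ext g p) :
  bdry_defect u (wedge1 Y w) = wedge2 (s Y u) w - wedge1 Y (bdry_defect u w).
Proof.
move: u; apply: ext_eq2; first exact: bdry_defect_linear_l.
  apply: linear_add.
    exact: (linear_comp (wedge2_linear_l w) (sigma_linear _ _)).
  exact/linear_opp/linear_comp/bdry_defect_linear_l/wedge1_linear.
move=> x z; rewrite !bdry_defect_wedge !wedge1_sigma sigma_wedge2 wedge2Dl.
rewrite !wedge2_wedge !(bracketC Y) // !wedge1Nl !wedge1D !wedge1N.
rewrite (wedge1C z (br x Y)) (wedge1C z Y) (wedge1C x Y) (wedge1C (br x z)).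
by zmod_cancel.
Qed.

Lemma bdry_defect0 u (w : ext g 0) : b u = 0 -> bdry_defect u w = 0.
Proof.
move=> bu; move: w; apply: ext_eq0; first exact: bdry_defect_linear.
  by move=> a x y; rewrite scaler0 addr0.
by rewrite /bdry_defect wedge2_1 bu oppr0.
Qed.

(** * The anticommutator of d and the boundary *)

Definition mixed_defect (p : nat) X (w : ext g p) : ext g p.+1 :=
  s X (d w) - d (s X w) + bdry_defect (delta X) w.

Lemma mixed_defect_linear p X : linear (@mixed_defect p X).
Proof.
apply: linear_add; last exact: bdry_defect_linear.
apply: linear_add; first exact/linear_comp/dext_linear/sigma_linear.
exact/linear_opp/linear_comp/sigma_linear/dext_linear.
Qed.

(** The three summands of the defect contribute, in order, - sigma(X)(delta Y), delta [X,Y] and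
    sigma(Y)(delta X) to the factor wedged with [w]; the remaining mixed terms cancel. *)
Lemma mixed_defect_wedge1 p X Y (w : ext g p) :
  mixed_defect X (wedge1 Y w) =
  wedge2 (delta (br X Y) - (s X (delta Y) - s Y (delta X))) w
  - wedge1 Y (mixed_defect X w).
Proof.
rewrite /mixed_defect bdry_defect_wedge1 wedge1_sigma !wedge1_dext dextD.
rewrite !wedge1_dext sigmaD !sigmaN wedge2_sigma wedge1_sigma wedge1D.
rewrite !wedge1D !wedge1N !wedge2Dl !wedge2Nl !wedge2Dl !wedge2Nl.
by zmod_cancel.
Qed.

(** In degree 0 only [bdry_defect] survives, and del (delta X) = 0 kills it; compatibility then
    carries the induction. *)
Lemma mixed_defect_eq0 p X (w : ext g p) :
  (forall X Y, delta (br X Y) = s X (delta Y) - s Y (delta X)) ->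
  (forall X, b (delta X) = 0) -> mixed_defect X w = 0.
Proof.
move=> compat invol; elim: p w => [|p IH] w.
  by rewrite /mixed_defect !dext0 sigma_0 bdry_defect0 // subr0 addr0.
move: w; apply: ext_eqS; first exact: mixed_defect_linear.
  by move=> a x y; rewrite scaler0 addr0.
move=> Y w; rewrite mixed_defect_wedge1 IH wedge1_0 compat subrr wedge2_0l.
exact: subr0.
Qed.

(** The lowest case of [dext_bdryS]: its first term is absent, as nothing lies below degree 0. *)
Lemma dext_bdry1 X (w : ext g 0) :
  d (b (wedge1 X w)) + b (d (wedge1 X w)) = mixed_defect X w.
Proof.
rewrite bdry_ext1 dext_0 add0r wedge1_dext dext0 wedge1_0 subr0 bdryN.
by rewrite /mixed_defect dext0 sigma_0 sigma0 dext_0 subrr add0r.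
Qed.

Lemma dext_bdryS p X (w : ext g p.+1) :
  d (b (wedge1 X w)) + b (d (wedge1 X w)) =
  wedge1 X (d (b w) + b (d w)) + mixed_defect X w.
Proof.
rewrite wedge1_dext bdryD !bdryN wedge1_bdry wedge1D /mixed_defect /bdry_defect.
case: p w => [|p] w.
  rewrite wedge1_bdry1 bdry_ext1 dext_0 wedge1_0 wedge2_0 dextN.
  by zmod_cancel.
rewrite wedge1_bdry dextD !dextN wedge1_dext.
by zmod_cancel.
Qed.

Lemma dext_bdry p (w : ext g p.+1) :
  (forall X Y, delta (br X Y) = s X (delta Y) - s Y (delta X)) ->
  (forall X, b (delta X) = 0) -> d (b w) + b (d w) = 0.
Proof.
move=> compat invol; elim: p w => [|p IH]; apply: ext_eqS;
  try by [move=> a x y; rewrite scaler0 addr0].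
- apply: linear_add; first exact/linear_comp/bdry_linear/dext_linear.
  exact/linear_comp/dext_linear/bdry_linear.
- by move=> X w; rewrite dext_bdry1 mixed_defect_eq0.
- apply: linear_add; first exact/linear_comp/bdry_linear/dext_linear.
  exact/linear_comp/dext_linear/bdry_linear.
- by move=> X w; rewrite dext_bdryS mixed_defect_eq0 // IH wedge1_0 addr0.
Qed.

End Operators.

(** * Antisymmetrization in degrees 2 and 3, and the cyclic sum *)

Section SmallExteriorPowers.
Variable V : lmodType rat.

(** A list of n! distinct permutations exhausts the group, so antisymmetrizers can be expanded over
    explicit lists. *)
Lemma sum_perm (n : nat) (W : zmodType) (r : seq 'S_n) (F : 'S_n -> W) :
  uniq r -> size r = n`! -> \sum_s F s = \sum_(s <- r) F s.
Proof.
move=> ur sr; apply: perm_big; rewrite perm_sym; apply: uniq_perm => //.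
  exact: index_enum_uniq.
have [||_ //] := uniq_min_size ur (s2 := index_enum 'S_n).
  by move=> s _; apply: mem_index_enum.
by rewrite sr -card_Sn cardT enumT.
Qed.

Lemma permute_tperm2 (X Y : V) :
  permute (tperm 0 1) [tuple X; Y] = [tuple Y; X].
Proof.
apply: eq_from_tnth => i; rewrite tnth_mktuple.
have [->|->] : i = 0 \/ i = 1.
  by case: i => -[|[|//]] ?; [left|right]; apply: val_inj.
  by rewrite tpermL.
by rewrite tpermR.
Qed.

Lemma wedge_tens2 (X Y : V) :
  ext_val (wedge [tuple X; Y]) = tens [tuple X; Y] - tens [tuple Y; X].
Proof.
rewrite /= /antisymmetrize (@sum_perm 2 _ [:: 1%g; tperm 0 1]) //; last first.
  rewrite /= andbT inE; apply/eqP => /perm.permP/(_ 0).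
  by rewrite perm1 tpermL.
rewrite !big_cons big_nil addr0 odd_perm1 odd_tperm expr1 scale1r scaleN1r.
by rewrite permute1 permute_tperm2.
Qed.

Lemma cycle3E : (cycle3 0 = 1) * (cycle3 1 = 2%:R) * (cycle3 2%:R = 0).
Proof. by rewrite /cycle3 !permE; do !split; apply: val_inj. Qed.

(** The cube of [cycle3] is 1, so the cube of its sign is 1, and hence the sign itself. *)
Lemma cycle3_even : odd_perm cycle3 = false.
Proof.
have : (cycle3 * cycle3 * cycle3)%g = 1%g.
  by apply/perm.permP=> -[[|[|[|//]]] i]; rewrite !permM perm1 /cycle3 !permE;
     apply: val_inj.
move/(congr1 (@odd_perm _)).
by rewrite !odd_permM odd_perm1; case: odd_perm.
Qed.

Lemma cyclic_sum_tens (X : 3.-tuple V) :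
  cyclic_sum (tens X) = tens X + tens (permute cycle3 X) +
    tens (permute (cycle3 * cycle3) X).
Proof. by rewrite /cyclic_sum !tpact_tens. Qed.

Lemma cyclic_sum_linear : linear (@cyclic_sum V).
Proof.
apply: linear_add; last exact: tpact_linear.
apply: linear_add => //; exact: tpact_linear.
Qed.

Lemma cyclic_sumB (x y : tpow V 3) :
  cyclic_sum (x - y) = cyclic_sum x - cyclic_sum y.
Proof. exact: (linearB (linear_of cyclic_sum_linear)). Qed.

(** S_3 is the union of the cosets A_3 and A_3 t, so the antisymmetrizer factors as N (1 - t). *)
Lemma antisymmetrize3 (X : 3.-tuple V) :
  antisymmetrize X = cyclic_sum (tens X - tens (permute (tperm 0 1) X)).
Proof.
set t := tperm 0 1.
rewrite cyclic_sumB !cyclic_sum_tens !permuteM /antisymmetrize.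
rewrite (@sum_perm 3 _ [:: 1; cycle3; cycle3 * cycle3; t;
  cycle3 * t; cycle3 * cycle3 * t]%g) //; last first.
  (* The six permutations are told apart by their values at 0 and 1. *)
  apply: (@map_uniq _ _ (fun s : 'S_3 => (s 0, s 1))).
  by rewrite [map _ _]/= !permM !perm1 !cycle3E tpermL tpermR tpermD.
rewrite !big_cons big_nil addr0 !odd_permM cycle3_even odd_tperm odd_perm1.
by rewrite /= expr0 !expr1 !scale1r !scaleN1r permute1 !opprD !addrA.
Qed.

Lemma tmulBl p q (x y : tpow V p) (z : tpow V q) :
  tmul (x - y) z = tmul x z - tmul y z.
Proof. exact: (linearB (linear_of (tmul_linear_l z))). Qed.

(** For u = x /\ y the tensor u (x) Z is already (1 - t)(x (x) y (x) Z), so [antisymmetrize3]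
    applies. This is the source of N in the coJacobi identity. *)
Lemma wedge2_cyclic (u : ext V 2) (Z : V) :
  ext_val (wedge2 u (wedge [tuple Z])) =
  cyclic_sum (tmul (ext_val u) (tens [tuple Z])).
Proof.
move: u; apply: ext_eq2.
- by move=> a x y; rewrite wedge2_linear_l.
- apply: linear_comp; first exact: cyclic_sum_linear.
  by move=> a x y; rewrite -tmul_linear_l.
move=> x y; rewrite wedge2_wedge !wedge1_wedge wedge_tens2.
rewrite tmulBl !tmul_tens [LHS]antisymmetrize3.
set T := [tuple of x :: _]; have -> : [tuple of [tuple x; y] ++ [tuple Z]] = T.
  exact: val_inj.
congr (cyclic_sum (_ - tens _)); apply: eq_from_tnth => i.
rewrite tnth_mktuple.
have [->|[->|->]] : i = 0 \/ i = 1 \/ i = 2%:R.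
- by case: i => -[|[|[|//]]] ?; [left|right; left|right; right]; apply: val_inj.
- by rewrite tpermL.
- by rewrite tpermR.
- by rewrite tpermD.
Qed.

(** On 1-tuples [thead] is multilinear and alternating, so its lift to Lambda^1 is a left
    inverse. *)
Lemma wedge_single_inj : injective (fun X : V => wedge [tuple X]).
Proof.
have m1 : multilinear (@thead 0 V).
  by move=> X i a x y; rewrite (ord1 i) /thead !tnth_mktuple.
have a1 : alternating (@thead 0 V).
  move=> s X; have -> : s = 1%g by apply/perm.permP => i; rewrite !ord1.
  by rewrite permute1 odd_perm1 scale1r.
move=> X Y /(congr1 (extlift (@thead 0 V))).
by rewrite !extlift_wedge.
Qed.

End SmallExteriorPowers.

(** * CoJacobi and involutivity in terms of d and the boundary *)

Section LowDegree.
Variables (g : lmodType rat) (nabla : {linear tpow g 2 -> g}).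
Variable delta : {linear g -> ext g 2}.

Lemma delta_tens1_linear : linear (delta_tens1 delta).
Proof.
apply: tlift_linear => Z i a x y.
have S1 z : [tuple z] = set_entry [tuple 0] 0 z :> 1.-tuple g.
  by apply: eq_from_tnth => j; rewrite tnth_mktuple (ord1 j) tnth0.
have [->|->] : i = 0 \/ i = 1.
  by case: i => -[|[|//]] ?; [left|right]; apply: val_inj.
  rewrite !tnth_mktuple /= linearP -[ext_val (_ + _)]/(val _) linearP /=.
  exact: (@tmul_linear_l g 2 1).
rewrite !tnth_mktuple /= ![tens [tuple _]](congr1 (@tens g 1) (S1 _)).
by rewrite tens_multilinear tmul_linear_r.
Qed.

Lemma delta_tens1B x y :
  delta_tens1 delta (x - y) = delta_tens1 delta x - delta_tens1 delta y.
Proof. exact: (linearB (linear_of delta_tens1_linear)). Qed.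

(** For u = x /\ y both sides are delta y /\ x - delta x /\ y, by [wedge2_cyclic]. At u = delta X
    this identifies coJacobi with d d X = 0. *)
Lemma dext_coJacobi (u : ext g 2) :
  ext_val (dext delta u) = - cyclic_sum (delta_tens1 delta (ext_val u)).
Proof.
move: u; apply: ext_eq2.
- by move=> a x y; rewrite dext_linear.
- apply: linear_opp; apply: linear_comp; first exact: cyclic_sum_linear.
  by move=> a x y; rewrite -delta_tens1_linear.
move=> x y; rewrite wedge_tens2 delta_tens1B.
rewrite !delta_tens1_tens cyclic_sumB -!wedge2_cyclic.
rewrite -wedge1_1wedge wedge1_dext dext_wedge1 wedge1N opprK opprB addrC.
by rewrite -[in RHS](wedge1_0wedge x) wedge2_wedge1 wedge2_1.
Qed.

Hypothesis lie_g : lie_algebra nabla.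

(** The factor 2 arises because del (x /\ y) = - [x,y], while [nabla] takes x (x) y - y (x) x to 2
    [x,y]. *)
Lemma bdry_wedge2 (u : ext g 2) :
  2%:R *: bdry nabla u = - wedge [tuple nabla (ext_val u)].
Proof.
rewrite -wedge1_0wedge; move: u; apply: ext_eq2.
- by move=> a x y; rewrite bdry_linear scalerDr !scalerA [2%:R * a]mulrC.
- apply: linear_opp => a x y; rewrite -wedge1_linear_l; congr wedge1.
  exact: linearP.
move=> x y; rewrite -{1}wedge1_1wedge wedge1_bdry1 // -{1}wedge1_0wedge.
rewrite wedge1_sigma sigma0 wedge1_0 addr0 wedge_tens2 linearB.
rewrite -![nabla (tens _)]/(bracket nabla _ _) (bracketC y) // opprK.
by rewrite scalerN scaler_nat wedge1Dl.
Qed.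

(** With u = delta X it turns involutivity into del (delta X) = 0, the form the recursions use. *)
Lemma bdry_eq0 (u : ext g 2) :
  bdry nabla u = 0 <-> nabla (ext_val u) = 0.
Proof.
have W0 : wedge [tuple 0] = 0 :> ext g 1.
  rewrite -wedge1_0wedge.
  exact: wedge1_0l.
have := bdry_wedge2 u; split=> u0.
  apply: wedge_single_inj; rewrite W0.
  by move: H; rewrite u0 scaler0 => /esym/eqP; rewrite oppr_eq0 => /eqP.
move: H; rewrite u0 W0 oppr0 => /eqP.
by rewrite scaler_eq0 => /orP[|/eqP].
Qed.

End LowDegree.

Theorem proposition0p0p1 (g : lmodType rat)
    (nabla : {linear tpow g 2 -> g}) (delta : {linear g -> ext g 2})
    (lie_g : lie_algebra nabla) :
  involutive_lie_bialgebra nabla delta <->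
  (forall x : (forall p : nat, ext g p), finitely_supported x ->
     (forall p, total_dext delta (total_dext delta x) p = 0) /\
     (forall p, total_dext delta (total_bdry nabla x) p +
                total_bdry nabla (total_dext delta x) p = 0)).
Proof.
split=> [[[_ coJ compat] inv] x _|H].
  have dd X : dext delta (delta X) = 0.
    by apply: val_inj; rewrite [LHS]dext_coJacobi coJ oppr0.
  have bd X : bdry nabla (delta X) = 0 by apply/bdry_eq0.
  (* The components of d d x in degrees 0 and 1 vanish by definition, and in degree 0 the
     anticommutator is 0 + 0. *)
  split=> [[|[|p]]|[|p]] //.
  - exact: dext_dext.
  - exact: addr0.
  - exact: dext_bdry.
(* Families concentrated in one degree, on which the hypothesis becomes an equation for a single
   element. *)
pose x1 X q : ext g q :=
  match q with 1 => wedge [tuple X] | _ => 0 end.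
pose x2 X Y q : ext g q :=
  match q with 2 => wedge [tuple X; Y] | _ => 0 end.
have f1 X : finitely_supported (x1 X) by exists 2 => -[|[|]].
have f2 X Y : finitely_supported (x2 X Y) by exists 3 => -[|[|[|]]].
have dd X : dext delta (delta X) = 0.
  have : dext delta (dext delta (wedge [tuple X])) = 0.
    exact: ((H _ (f1 X)).1 3).
  by rewrite dext_wedge1 dextN => /eqP; rewrite oppr_eq0 => /eqP.
have db1 X : dext delta (bdry nabla (wedge [tuple X])) +
             bdry nabla (dext delta (wedge [tuple X])) = 0.
  exact: ((H _ (f1 X)).2 1).
have bd X : bdry nabla (delta X) = 0.
  have := db1 X; rewrite bdry_ext1 dext_0 add0r dext_wedge1 bdryN => /eqP.
  by rewrite oppr_eq0 => /eqP.
split; last by move=> X; apply/(bdry_eq0 lie_g).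
split=> // [X|X Y].
  by apply: oppr_inj; rewrite -dext_coJacobi dd oppr0.
have db2 : dext delta (bdry nabla (wedge [tuple X; Y])) +
           bdry nabla (dext delta (wedge [tuple X; Y])) = 0.
  exact: ((H _ (f2 X Y)).2 2).
(* On X /\ Y the anticommutator is X /\ 0 + E_X(Y). Writing Y = Y /\ 1, E_X(Y) is the failure of
   compatibility minus Y /\ E_X(1), and E_X(1) is the anticommutator at [X], which is 0. *)
move: db2; rewrite -wedge1_1wedge dext_bdryS // db1 wedge1_0 add0r.
rewrite -(wedge1_0wedge Y) mixed_defect_wedge1 // wedge2_1 -dext_bdry1.
by rewrite wedge1_0wedge db1 wedge1_0 subr0 => /subr0_eq.
Qed.
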